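(* Let $s \geq 1$ and $\alpha \in \mathbb{R}$. The dynamical system $(\mathbb{T}^1, \mu, T_\alpha)$ has the $s$-exponent monotone shrinking target property ($s$MSTP) if and only if $\alpha \in \Omega(s-1)$.
   Context: $\mathbb{T}^1 = \mathbb{R}/\mathbb{Z}$, $\mu$ is the probability Haar measure on $\mathbb{T}^1$, and $T_\alpha:\mathbb{T}^1\to\mathbb{T}^1$ is $T_\alpha(x) = x+\alpha$. For $a\in\mathbb{R}$, $\|a\| := \inf_{p\in\mathbb{Z}}|a-p|$; the metric on $\mathbb{T}^1$ is $(x,y)\mapsto\|x-y\|$, and $B(x,r)$ denotes the open ball of center $x$ and radius $r$ (empty if $r=0$). For $\sigma\ge 0$, $\Omega(\sigma) := \{\alpha\in\mathbb{R} \mid \exists C>0 \text{ such that } \forall k\in\mathbb{N},\ \|k\alpha\|\ge C k^{-(1+\sigma)}\}$, where $\mathbb{N}=\{1,2,\dots\}$. $\mathcal{DR}$ is the set of functions $r:\mathbb{N}\to\mathbb{R}_{\ge 0}$, $n \mapsto r_n$, with $r_n\ge r_{n+1}$ for all $n\in\mathbb{N}$. Let $(M,\mu,T)$ be a measure preserving dynamical system on a metric space $M$ with $\mu(M)<\infty$ and Borel sets measurable. A sequence of measurable sets $\{A_n\}_{n\in\mathbb{N}}$ with $\sum_{n=1}^\infty\mu(A_n)=\infty$ is called Borel–Cantelli (BC) for $T$ if $\mu(\limsup_n T^{-n}A_n)=\mu(M)$, where $\limsup_n T^{-n}A_n = \{x\in M \mid T^n(x)\in A_n \text{ for infinitely many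 } n\in\mathbb{N}\}$. For $s\ge 1$, the system has the $s$-exponent monotone shrinking target property ($s$MSTP) if for any $x\in M$ and any $r\in\mathcal{DR}$ such that $A_n := B(x,r_n)$ satisfies $\sum_{n=1}^\infty(\mu(A_n))^s=\infty$, the sequence $\{A_n\}$ is BC for $T$. *)

(* Defs.v *)
From HB Require Import structures.
From mathcomp Require Import all_boot all_order all_algebra.
From mathcomp Require Import all_classical all_reals all_analysis.
From mathcomp Require Import measurable_realfun.

Set Implicit Arguments.
Unset Strict Implicit.
Unset Printing Implicit Defensive.

Import Order.TTheory GRing.Theory Num.Theory.
Import numFieldNormedType.Exports.

Local Open Scope classical_set_scope.
Local Open Scope ring_scope.
Local Open Scope quotient_scope.

Section distance_to_integers.
Context {R : realType}.
Implicit Types a b : R.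

Definition dist_int a : R := inf [set `|a - p%:~R| | p in [set: int]].

Lemma dist_int_has_inf a : has_inf [set `|a - p%:~R| | p in [set: int]].
Proof.
split; first by exists `|a - 0%:~R|, 0.
by exists 0 => _ [p _ <-].
Qed.

Lemma dist_int_le a (p : int) : dist_int a <= `|a - p%:~R|.
Proof. by apply: ge_inf; [exact: (dist_int_has_inf a).2|exists p]. Qed.

Lemma dist_int_ge a (e : R) : (forall p : int, e <= `|a - p%:~R|) ->
  e <= dist_int a.
Proof.
move=> h; apply: lb_le_inf; first exact: (dist_int_has_inf a).1.
by move=> _ [p _ <-].
Qed.

Lemma dist_int_ge0 a : 0 <= dist_int a.
Proof. by apply: dist_int_ge => p. Qed.

Lemma dist_intN a : dist_int (- a) = dist_int a.
Proof.
wlog suff h : a / dist_int (- a) <= dist_int a.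
  by apply/eqP; rewrite eq_le h/= -{1}(opprK a) h.
apply: dist_int_ge => p; apply: le_trans (dist_int_le _ (- p)) _.
by rewrite mulrNz -opprD normrN.
Qed.

Lemma dist_intD a b : dist_int (a + b) <= dist_int a + dist_int b.
Proof.
rewrite -lerBlDr; apply: dist_int_ge => p.
rewrite lerBlDr [leRHS]addrC -lerBlDr; apply: dist_int_ge => q.
rewrite lerBlDr; apply: le_trans (dist_int_le _ (p + q)) _.
by rewrite intrD opprD addrACA [leRHS]addrC ler_normD.
Qed.

Lemma dist_int0P a : reflect (dist_int a = 0) (a \is a Num.int).
Proof.
apply: (iffP idP) => [/intrP[p ->]|a0].
  apply/eqP; rewrite eq_le dist_int_ge0 andbT.
  by apply: le_trans (dist_int_le _ p) _; rewrite subrr normr0.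
apply/negPn/negP => aZ.
have fa : (Num.floor a)%:~R < a.
  by rewrite lt_neqAle floor_le_tmp andbT; apply/negP => /eqP h;
     move: aZ; rewrite -h intr_int.
have af : a < (Num.floor a + 1)%:~R by exact: floorD1_gt.
suff : 0 < dist_int a by rewrite a0 ltxx.
apply: (@lt_le_trans _ _
  (Num.min (a - (Num.floor a)%:~R) ((Num.floor a + 1)%:~R - a))).
  by rewrite lt_min !subr_gt0 fa.
apply: dist_int_ge => p; rewrite ge_min.
have [pf|fp] := leP p (Num.floor a).
  rewrite ger0_norm ?lerD2l ?lerN2 ?ler_int ?pf// subr_ge0.
  by rewrite (le_trans _ (ltW fa))// ler_int.
apply/orP; right; rewrite distrC ger0_norm.
  by rewrite lerD2r ler_int lezD1.
by rewrite subr_ge0 (le_trans (ltW af))// ler_int lezD1.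
Qed.

Lemma dist_intD_int a b : b \is a Num.int -> dist_int (a + b) = dist_int a.
Proof.
move=> bZ; apply/eqP; rewrite eq_le; apply/andP; split.
  by apply: le_trans (dist_intD _ _) _; rewrite (dist_int0P _ bZ) addr0.
rewrite -{1}(addrK b a); apply: le_trans (dist_intD _ _) _.
by rewrite dist_intN (dist_int0P _ bZ) addr0.
Qed.

End distance_to_integers.

HB.mixin Record hasMeasurableOpen (R : numDomainType) d M
    & Metric R M & Measurable d M := {
  measurable_open : forall U : set M, open U -> measurable U
}.

#[short(type="borelMetricType")]
HB.structure Definition BorelMetric (R : numDomainType) d :=
  {M of Metric R M & Measurable d M & hasMeasurableOpen R d M}.

Section dynamical_systems.
Context {R : realType} {d : measure_display} {M : borelMetricType R d}.

Record mp_system := MPSystem {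
  sys_measure : {finite_measure set M -> \bar R} ;
  sys_map : M -> M ;
  sys_measurable : measurable_fun [set: M] sys_map ;
  sys_preserving : forall A, measurable A ->
    sys_measure (sys_map @^-1` A) = sys_measure A
}.

(* Sequences over {1, 2, ...} are functions on nat whose value at 0 is
   irrelevant. *)

Definition limsup_preimage (T : M -> M) (A : nat -> set M) : set M :=
  [set x | infinite_set [set n | (0 < n)%N /\ A n (iter n T x)]].

Definition Borel_Cantelli (S : mp_system) (A : nat -> set M) : Prop :=
  [/\ forall n, (0 < n)%N -> measurable (A n),
      (\sum_(1 <= n <oo) sys_measure S (A n) = +oo)%E &
      sys_measure S (limsup_preimage (sys_map S) A) = sys_measure S [set: M]].

Definition DR : set (nat -> R) :=
  [set r | forall n, (0 < n)%N -> 0 <= r n /\ r n.+1 <= r n].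

Definition sMSTP (s : R) (S : mp_system) : Prop :=
  forall (x : M) (r : nat -> R), DR r ->
    (\sum_(1 <= n <oo) (sys_measure S (ball x (r n)) `^ s) = +oo)%E ->
    Borel_Cantelli S (fun n => ball x (r n)).

End dynamical_systems.
Arguments mp_system {R d} M.

Definition Omega (R : realType) (sigma : R) : set R :=
  [set alpha | exists2 C : R, 0 < C &
    forall k : nat, (0 < k)%N ->
      C * k%:R `^ (- (1 + sigma)) <= dist_int (k%:R * alpha)].

Section circle.
Context (R : realType).

Definition int_subgroup : zmodClosed R :=
  GRing.ZmodClosed.clone R (@Num.int_num_subdef R) _.

Definition circle : Type := {ideal_quot int_subgroup}.

HB.instance Definition _ := GRing.Zmodule.copy circle {ideal_quot int_subgroup}.
HB.instance Definition _ := EqQuotient.copy circle {ideal_quot int_subgroup}.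
HB.instance Definition _ := isPointed.Build circle 0.

Definition toC (a : R) : circle := \pi_circle a.

Lemma toC_eq a b : (toC a == toC b) = (a - b \is a Num.int).
Proof. by rewrite /toC -(Quotient.idealrBE int_subgroup). Qed.

Lemma toCD a b : toC (a + b) = toC a + toC b.
Proof. by rewrite /toC !piE. Qed.

Lemma toCN a : toC (- a) = - toC a.
Proof. by rewrite /toC !piE. Qed.

Lemma toCK (x : circle) : toC (repr x) = x.
Proof. exact: reprK. Qed.

(* The choice of the representative of x - y is irrelevant: see circle_distE. *)
Definition circle_dist (x y : circle) : R := dist_int (repr (x - y)).

Lemma circle_distE a b : circle_dist (toC a) (toC b) = dist_int (a - b).
Proof.
rewrite /circle_dist; set c := repr _.
have cZ : c - (a - b) \is a Num.int by rewrite -toC_eq toCK toCD toCN.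
by rewrite -(dist_intD_int (a - b) cZ) addrC subrK.
Qed.

Fact circle_distxx x : circle_dist x x = 0.
Proof. by rewrite -(toCK x) circle_distE subrr; apply/dist_int0P; rewrite rpred0. Qed.

Fact circle_dist_eq0 x y : circle_dist x y = 0 -> x = y.
Proof.
rewrite -(toCK x) -(toCK y) circle_distE => /dist_int0P h.
by apply/eqP; rewrite toC_eq.
Qed.

Fact circle_dist_sym x y : circle_dist x y = circle_dist y x.
Proof. by rewrite -(toCK x) -(toCK y) !circle_distE -dist_intN opprB. Qed.

Fact circle_dist_triangle y x z :
  circle_dist x z <= circle_dist x y + circle_dist y z.
Proof.
rewrite -(toCK x) -(toCK y) -(toCK z) !circle_distE.
by rewrite (le_trans _ (dist_intD _ _))// addrA subrK.
Qed.

HB.instance Definition _ := @isMetric.Build R circle circle_dist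
  circle_distxx circle_dist_eq0 circle_dist_sym circle_dist_triangle.

HB.instance Definition _ := Measurable.copy circle
  (g_sigma_algebraType (@open circle)).

Lemma circle_measurable_open (U : set circle) : open U -> measurable U.
Proof. exact: sub_gen_smallest. Qed.

HB.instance Definition _ := @hasMeasurableOpen.Build R
  (sigma_display (@open circle)) circle circle_measurable_open.

Lemma ball_circleE (a b e : R) : ball (toC a) e (toC b) <-> dist_int (a - b) < e.
Proof. by rewrite ballEmdist/= -circle_distE. Qed.

Lemma toC_continuous : continuous (toC : R -> circle).
Proof.
move=> a; apply/cvg_ballP => e e0; near=> b.
apply/ball_circleE; apply: le_lt_trans (dist_int_le _ 0) _.
by rewrite subr0; near: b; exact: (nbhsx_ballx a e e0).
Unshelve. all: by end_near. Qed.

Lemma measurable_toC :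
  measurable_fun [set: measurableTypeR R] (toC : measurableTypeR R -> circle).
Proof.
apply: (@measurability _ _ _ circle _ _ (@open circle)) => // _ [U oU <-].
rewrite setTI; apply: open_measurable.
by move/continuousP: toC_continuous; exact.
Qed.

Fact measurable_unit_itv :
  measurable (`[0, 1[%classic : set (measurableTypeR R)).
Proof. exact: measurable_itv. Qed.

(* Probability Haar measure, as the image of Lebesgue measure on [0, 1[;
   haar_rotation is its translation invariance. *)
Definition haar : set circle -> \bar R :=
  pushforward (mrestr lebesgue_measure measurable_unit_itv)
    (toC : measurableTypeR R -> circle).

Fact haar0 : haar set0 = 0%E.
Proof. by rewrite /haar /pushforward preimage_set0 measure0. Qed.

Fact haar_ge0 A : (0 <= haar A)%E.
Proof. exact: (measure_ge0 (mrestr lebesgue_measure measurable_unit_itv)). Qed.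

Fact haar_sigma_additive : semi_sigma_additive haar.
Proof.
move=> F mF tF mUF; rewrite /haar /pushforward preimage_bigcup.
apply: measure_semi_sigma_additive.
- by move=> n; rewrite -[X in measurable X]setTI; exact: measurable_toC.
- apply/trivIsetP => /= i j _ _ ij; rewrite -preimage_setI.
  by move/trivIsetP : tF => /(_ _ _ _ _ ij) ->//; rewrite preimage_set0.
- by rewrite -preimage_bigcup -[X in measurable X]setTI; exact: measurable_toC.
Qed.

HB.instance Definition _ := isMeasure.Build _ circle R haar
  haar0 haar_ge0 haar_sigma_additive.

Lemma haarE A :
  haar A = lebesgue_measure ((toC @^-1` A) `&` `[0, 1[%classic).
Proof. by []. Qed.

Fact haar_setT : haar [set: circle] = 1%E.
Proof.
by rewrite haarE preimage_setT setTI lebesgue_measure_itv/= lte01 oppr0 adde0.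
Qed.

HB.instance Definition _ := Measure_isProbability.Build _ circle R haar haar_setT.

Fact lebesgue_measure_shift (a : R) (A : set (measurableTypeR R)) :
  measurable A ->
  lebesgue_measure ((fun x => x + a) @^-1` A) = lebesgue_measure A.
Proof.
move=> mA; pose f := fun x : measurableTypeR R => x + a : measurableTypeR R.
have mf : measurable_fun setT f.
  by apply: measurable_funD => //; exact: measurable_cst.
rewrite -[LHS]/(pushforward lebesgue_measure f A).
apply/esym/lebesgue_measure_unique => //= _ [[u v]] _ <-.
rewrite /pushforward (_ : f @^-1` _ = `]u - a, v - a]%classic); last first.
  by apply/seteqP; split => x /=; rewrite !in_itv/= /f ltrBlDr lerBrDr.
by rewrite !lebesgue_measure_itv/= !lte_fin ltrD2r -!EFinB opprB addrA subrK.
Qed.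

Definition rotation_map (alpha : R) (x : circle) : circle := x + toC alpha.

Fact measurable_rotation alpha :
  measurable_fun [set: circle] (rotation_map alpha).
Proof.
apply: (@measurability _ _ _ circle _ _ (@open circle)) => // _ [U oU <-].
rewrite setTI; apply: measurable_open.
have : continuous (rotation_map alpha).
  move=> x; apply/(@cvg_ballP R circle _ _ (nbhs_filter x)) => e e0.
  apply: filterS (nbhsx_ballx x e e0) => y.
  rewrite !ballEmdist/= /mdist/= /circle_dist /rotation_map.
  by rewrite opprD addrACA subrr addr0.
by move/continuousP; exact.
Qed.

Lemma haar_rotation alpha (A : set circle) : measurable A ->
  haar (rotation_map alpha @^-1` A) = haar A.
Proof.
move=> mA; pose B : set (measurableTypeR R) := toC @^-1` A.
have mB : measurable B by rewrite -[B]setTI; exact: measurable_toC.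
have toCDz x (p : int) : toC (x + p%:~R) = toC x.
  by apply/eqP; rewrite toC_eq addrC addKr intr_int.
pose f := alpha - (Num.floor alpha)%:~R.
have f0 : 0 <= f by rewrite subr_ge0 floor_le_tmp.
have f1 : f < 1 by rewrite ltrBlDr addrC -intrD1 floorD1_gt.
have mBI (i : interval R) : measurable (B `&` [set` i]).
  by apply: measurableI => //; exact: measurable_itv.
have BU (u v w : R) : u <= v -> v <= w ->
    lebesgue_measure (B `&` `[u, w[) =
    (lebesgue_measure (B `&` `[u, v[) + lebesgue_measure (B `&` `[v, w[))%E.
  move=> uv vw; rewrite -measureU//.
    by rewrite -setIUr -itv_bndbnd_setU.
  apply/seteqP; split => // x [[_ /=]]; rewrite !in_itv/= => /andP[_ xv] [_].
  by rewrite leNgt xv.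
rewrite !haarE; transitivity (lebesgue_measure (B `&` `[f, 1 + f[)).
  rewrite -[RHS](lebesgue_measure_shift f (mBI _)); congr (lebesgue_measure _).
  rewrite preimage_setI; congr (_ `&` _).
    apply/seteqP; split => x; rewrite /B /rotation_map /= -toCD => h.
      by rewrite -(toCDz _ (Num.floor alpha)) -addrA subrK.
    by rewrite -(toCDz _ (Num.floor alpha)) -addrA subrK in h.
  by apply/seteqP; split => x /=; rewrite !in_itv/= -lerBlDr subrr ltrD2r.
rewrite (BU f 1 (1 + f)) ?lerDl ?(ltW f1)// (BU 0 f 1) ?(ltW f1)// addeC.
congr (_ + _)%E; rewrite -[LHS](lebesgue_measure_shift 1 (mBI _)).
congr (lebesgue_measure _); rewrite preimage_setI; congr (_ `&` _).
  by apply/seteqP; split => x; rewrite /B /= (toCDz x 1).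
apply/seteqP; split => x /=; rewrite !in_itv/= -lerBlDr subrr.
  by rewrite addrC ltrD2l.
by rewrite [x + 1]addrC ltrD2l.
Qed.

Definition rotation (alpha : R) : mp_system circle :=
  MPSystem (measurable_rotation alpha) (@haar_rotation alpha).

End circle.

(* Main.v *)
Require Import Defs.
From mathcomp Require Import all_boot all_order all_algebra.
From mathcomp Require Import all_classical all_reals all_analysis.
From mathcomp Require Import lra ring zify.

Set Implicit Arguments.
Unset Strict Implicit.
Unset Printing Implicit Defensive.
Import Order.TTheory GRing.Theory Num.Theory.
Import numFieldNormedType.Exports.
Local Open Scope classical_set_scope.
Local Open Scope ring_scope.

(**
Sufficiency: let alpha be in Omega (s - 1) and suppose that the points whose
orbit avoids all targets from time M on form a set F of measure m > 0.
By Dirichlet, any N >= B P^s consecutive orbit points are 1/(4P)-dense. Hence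
for P_l = K^l and N_l ~ B P_l^s each of the P_l cells [k/P_l, (k+1)/P_l)
contains a ball of radius rho_l = r_(M + N_l) missed by F. The balls of earlier
stages have at most 2 (P_0 + ... + P_(l-1)) endpoints, few compared to P_l, so
they are nearly unions of cells of stage l, and the balls of stage l lying in
cells that they miss have total measure at least rho_l P_l m. Thus the sum of
the rho_l P_l is bounded by 1/m; as rho_l P_l <= 1/4 and s >= 1, so is that of
(rho_l P_l)^s, and Cauchy condensation bounds the sum of the r_n^s.

Necessity: otherwise, for every j there is q with q^s ||q alpha|| as small as
wanted. With rho = eps_j / q and N ~ j / rho^s, the first N preimages of
B(0, rho) lie in q balls of total measure at most 4 eps_j, while N rho^s >= j.
*)

(** * Diophantine approximation and density of finite orbits *)

Lemma dirichlet_approx (R : realType) (alpha : R) (N : nat) : (0 < N)%N ->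
  exists q : nat, exists p : int,
    [/\ (0 < q <= N)%N & `|q%:R * alpha - p%:~R| < N%:R^-1].
Proof.
move=> N0; have N0R : 0 < N%:R :> R by rewrite ltr0n.
pose fr (k : nat) : R := k%:R * alpha - (Num.floor (k%:R * alpha))%:~R.
have fr0 k : 0 <= fr k by rewrite subr_ge0 floor_le_tmp.
have fr1 k : fr k < 1 by rewrite ltrBlDr addrC -intrD1 floorD1_gt.
have frN (k : nat) : (Num.truncn (N%:R * fr k)%R < N)%N.
  rewrite truncn_lt_nat ?mulr_ge0//.
  by rewrite -[ltRHS]mulr1 ltr_pM2l.
pose f (k : 'I_N.+1) : 'I_N := Ordinal (frN k).
(* Pigeonhole: the [N + 1] fractional parts fall into [N] boxes of width [1/N], so two of them share
   a box and their difference is less than [1/N]. *)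
have /injectivePn[a [b ab fab]] : ~~ injectiveb f.
  apply/negP => /injectiveP/leq_card; rewrite !card_ord; lia.
wlog lab : a b ab fab / (a < b)%N.
  move=> h; have [|ba] := ltnP a b; first exact: h.
  apply: (h b a) => //; first by rewrite eq_sym.
  by rewrite ltn_neqAle ba andbT; apply: contraNneq ab => /val_inj ->.
exists (b - a)%N.
exists (Num.floor (b%:R * alpha) - Num.floor (a%:R * alpha)); split.
  by have := ltn_ord b; lia.
rewrite natrB 1?ltnW// mulrBl intrB.
have -> : b%:R * alpha - a%:R * alpha -
    ((Num.floor (b%:R * alpha))%:~R - (Num.floor (a%:R * alpha))%:~R) =
    fr b - fr a by rewrite /fr; ring.
have tr (k : nat) : (Num.truncn (N%:R * fr k))%:R <= N%:R * fr k
    < (Num.truncn (N%:R * fr k)).+1%:R by apply: truncn_itv; rewrite mulr_ge0// ltW.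
have := congr1 val fab => /= E.
have := tr a; have := tr b; rewrite E => /andP[b1 b2] /andP[a1 a2].
rewrite -(ltr_pM2l N0R) mulfV ?gt_eqF// -{1}(gtr0_norm N0R) -normrM ltr_norml mulrBr.
move: b2 a2; rewrite -natr1; lra.
Qed.

(* The least q with |q alpha - p| < 1/N makes p/q reduced, so the multiples
   n alpha with n < q shadow all the fractions t/q. *)
Lemma orbit_net (R : realType) (alpha : R) (N : nat) : (0 < N)%N ->
  exists q : nat, [/\ (0 < q <= N)%N, dist_int (q%:R * alpha) < N%:R^-1 &
    forall y : R, exists n : nat, exists w : int,
      (n < q)%N /\ `|y - n%:R * alpha + w%:~R| < 2 / q%:R].
Proof.
move=> N0; have N0R : 0 < N%:R :> R by rewrite ltr0n.
pose Q (q : nat) := (0 < q)%N &&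
  `[< exists p : int, `|q%:R * alpha - p%:~R| < N%:R^-1 >].
have exQ : exists q, Q q.
  have [q [p [/andP[q0 _] h]]] := dirichlet_approx alpha N0.
  by exists q; rewrite /Q q0; apply/asboolP; exists p.
case: (ex_minnP exQ) => q /andP[q0 /asboolP[p hp]] qmin.
have q0R : 0 < q%:R :> R by rewrite ltr0n.
have qN : (q <= N)%N.
  have [q' [p' [/andP[q'0 q'N] h]]] := dirichlet_approx alpha N0.
  by apply: leq_trans q'N; apply: qmin; rewrite /Q q'0; apply/asboolP; exists p'.
exists q; split; first by rewrite q0.
  exact: le_lt_trans (dist_int_le _ p) _.
(* Dividing [q] and [p] by a common factor [g] also divides the error by [g], so by minimality of
   [q] there is no such factor beyond 1. *)
have g1 : gcdz q p = 1.
  have gN0 : (gcdz q p != 0)%R by rewrite gcdz_eq0; lia.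
  have /dvdzP[q' eq'] := dvdz_gcdl q p.
  have /dvdzP[p' ep'] := dvdz_gcdr q p.
  have gp : 0 < gcdz q p by rewrite lt0r gN0.
  move: gN0 eq' ep' gp; set g := gcdz q p => gN0 eq' ep' gp.
  have q'p : 0 < q' by rewrite -(pmulr_lgt0 _ gp) -eq'.
  have := qmin `|q'|%N; rewrite /Q absz_gt0 gt_eqF//= => h.
  have {h} : (q <= `|q'|)%N.
    apply: h; apply/asboolP; exists p'; apply: le_lt_trans hp.
    have -> : q%:R = q'%:~R * g%:~R :> R by rewrite -intrM -eq'.
    have -> : `|q'|%:R = q'%:~R :> R by rewrite natr_absz gtr0_norm.
    rewrite ep' intrM.
    rewrite mulrAC -mulrBl normrM ler_peMr//.
    by rewrite gtr0_norm ?ltr0z// ler1z.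
  move=> h; have : g <= 1 by nia.
  by move=> ?; apply/eqP; rewrite eq_le; lia.
(* [v] inverts [p] modulo [q]. With [t] the floor of [q * y], the fraction [t/q] is within [1/q] of
   [y], and [n = t * v mod q] is the time at which [n * p/q] equals [t/q] modulo 1. *)
have [u [v]] := Bezoutz q p.
rewrite g1 => bez y; pose t := Num.floor (q%:R * y).
pose n := `|((t * v) %% q)%Z|%N.
have qZ : (q : int) != 0 by lia.
have nE : (n : int) = ((t * v) %% q)%Z by rewrite /n gez0_abs// modz_ge0.
have nq : (n < q)%N by rewrite -ltz_nat nE ltz_pmod//; lia.
pose w := t * u + ((t * v) %/ q)%Z * p.
have tE : t = n%:Z * p + q%:Z * w.
  have := divz_eq (t * v) q; rewrite -nE => e.
  have : t * u * q + (t * v) * p = t by rewrite -!mulrA -mulrDr bez mulr1.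
  by rewrite /w; move: (_ %/ _)%Z e => k -> {1}<-; ring.
have tER : t%:~R = n%:R * p%:~R + q%:R * w%:~R :> R.
  by rewrite tE intrD !intrM.
exists n, (- w); split=> //.
rewrite -(ltr_pM2l q0R) -{1}(gtr0_norm q0R) -normrM mulrCA divff ?gt_eqF// mulr1.
(* Two errors add up: rounding [q * y] down costs less than 1, and replacing [alpha] by [p/q] costs
   at most [n/N <= 1]. *)
have -> : q%:R * (y - n%:R * alpha + (- w)%:~R) =
    (q%:R * y - t%:~R) - n%:R * (q%:R * alpha - p%:~R).
  by rewrite tER mulrNz; ring.
have y1 : 0 <= q%:R * y - t%:~R by rewrite subr_ge0 floor_le_tmp.
have y2 : q%:R * y - t%:~R < 1 by rewrite ltrBlDr addrC -intrD1 floorD1_gt.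
have : `|n%:R * (q%:R * alpha - p%:~R)| <= 1.
  rewrite normrM normr_nat -[leRHS](@divff _ N%:R) ?gt_eqF//.
  by apply: ler_pM => //; [rewrite ler_nat (leq_trans (ltnW nq))|exact: ltW].
by rewrite ler_norml ltr_norml => /andP[? ?]; apply/andP; split; lra.
Qed.

(** The [q] given by [orbit_net] has distance from [q * alpha] to the integers below [1/N], while
    the Diophantine condition keeps it above [C / q^s]. Hence [q^s > C * N >= (8 P)^s], and the mesh
    [2/q] is at most [1/(4 P)]; this is where [B = 8^s / C] comes from. *)
Lemma orbit_net_Omega (R : realType) (s alpha : R) : 1 <= s ->
  Omega (s - 1) alpha -> exists2 B : R, 0 < B &
  forall P N : nat, (0 < P)%N -> B * P%:R `^ s <= N%:R ->
  forall y : R, exists n : nat, exists w : int,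
    (n < N)%N /\ `|y - n%:R * alpha + w%:~R| < (4 * P%:R)^-1.
Proof.
move=> s1 [C C0 hC]; have s0 : 0 < s by lra.
exists (8 `^ s / C) => [|P N P0 hN y]; first by rewrite divr_gt0// powR_gt0.
have P0R : 0 < P%:R :> R by rewrite ltr0n.
have NR0 : 0 < N%:R :> R.
  by apply: lt_le_trans hN; rewrite mulr_gt0 ?divr_gt0 ?powR_gt0.
have N0 : (0 < N)%N by rewrite -(ltr0n R).
have [q [/andP[q0 qN] qd net]] := orbit_net alpha N0.
have q0R : 0 < q%:R :> R by rewrite ltr0n.
have [n [w [nq h]]] := net y; exists n, w; split; first exact: leq_trans nq qN.
apply: lt_le_trans h _.
suff : 8 * P%:R <= q%:R :> R.
  move=> h; rewrite ler_pdivrMr// mulrC ler_pdivlMr; last by lra.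
  by lra.
have := hC q q0; rewrite [1 + _]addrC subrK => /le_lt_trans/(_ qd).
rewrite powRN ltr_pdivrMr ?powR_gt0// mulrC ltr_pdivlMr// => hCN.
rewrite leNgt; apply/negP => qP.
have := gt0_ltr_powR s0 _ _ qP; rewrite !nnegrE !ltW ?mulr_gt0// powRM//.
move=> /(_ erefl erefl)/(lt_trans hCN).
by rewrite ltNge [C * _]mulrC -ler_pdivrMr// mulrAC hN.
Qed.

(** * Partition into cells and the mass gained at one stage *)

Definition cell (R : realType) (P k : nat) : set R :=
  `[k%:R / P%:R, k.+1%:R / P%:R[%classic.

Definition mixed (R : realType) (V : set R) (P k : nat) : bool :=
  `[< cell P k `&` V !=set0 >] && ~~ `[< cell P k `<=` V >].

Lemma cellP (R : realType) (P k : nat) (x : R) : (0 < P)%N ->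
  cell P k x <-> k%:R <= P%:R * x < k.+1%:R.
Proof.
move=> P0; have P0R : 0 < P%:R :> R by rewrite ltr0n.
by rewrite /cell/= in_itv/= ler_pdivrMr// ltr_pdivlMr// [x * _]mulrC.
Qed.

Lemma cell_inj (R : realType) (P k l : nat) (x : R) : (0 < P)%N ->
  cell P k x -> cell P l x -> k = l.
Proof.
move=> P0 /cellP-/(_ P0)/andP[k1 k2] /cellP-/(_ P0)/andP[l1 l2].
have := le_lt_trans k1 l2; have := le_lt_trans l1 k2.
by rewrite !ltr_nat; lia.
Qed.

Lemma cell_cover (R : realType) (P : nat) (x : R) : (0 < P)%N -> 0 <= x < 1 ->
  exists2 k : nat, (k < P)%N & cell P k x.
Proof.
move=> P0 /andP[x0 x1]; have P0R : 0 < P%:R :> R by rewrite ltr0n.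
exists (Num.truncn (P%:R * x)); last first.
  by apply/cellP => //; apply: truncn_itv; rewrite mulr_ge0.
by rewrite truncn_lt_nat ?mulr_ge0// -[ltRHS]mulr1 ltr_pM2l.
Qed.

Lemma sum_cell_le1 (R : realType) (P : nat) (x : R) : (0 < P)%N ->
  (\sum_(k < P) `[< cell P k x >] <= 1)%N.
Proof.
move=> P0; have [[k0 xk0]|] := pselect (exists k : 'I_P, cell P k x).
  rewrite (bigD1 k0)//= big1 ?addn0 ?leq_b1// => k kk0.
  apply/eqP; rewrite eqb0; apply/asboolPn => xk.
  by move/eqP: kk0; apply; apply: val_inj; exact: cell_inj xk xk0.
move=> h; rewrite big1// => k _; apply/eqP; rewrite eqb0; apply/asboolPn => xk.
by apply: h; exists k.
Qed.

(** A cell that meets the interval without lying inside it contains one of the two endpoints, and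
    each endpoint lies in at most one cell. *)
Lemma sum_mixed_itv (R : realType) (u v : R) (P : nat) : (0 < P)%N ->
  (\sum_(k < P) mixed `]u, v[%classic P k <= 2)%N.
Proof.
move=> P0.
suff h (k : nat) : (mixed `]u, v[%classic P k <= `[< cell P k u >] + `[< cell P k v >])%N.
  apply: (@leq_trans (\sum_(k < P) (`[< cell P k u >] + `[< cell P k v >]))).
    by apply: leq_sum => k _; exact: h.
  by rewrite big_split -[2%N]/(1 + 1)%N leq_add// sum_cell_le1.
case: (boolP (mixed _ _ _)) => // /andP[/asboolP[x [xk]]] /=.
rewrite in_itv/= => /andP[ux xv] /asboolPn/existsNP[y /not_implyP[yk]].
rewrite /= in_itv/= => /negP; rewrite negb_and -!leNgt => yuv.
rewrite addn_gt0 !lt0b; apply/orP.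
move: xk yk; rewrite /cell/= !in_itv/= => /andP[x1 x2] /andP[y1 y2].
case/orP : yuv => h; [left|right]; apply/asboolP; rewrite /cell/=; apply/andP; split; lra.
Qed.

(** A cell that is mixed for a union meets one of the sets and cannot lie inside that set, so it is
    mixed for it. *)
Lemma sum_mixed_bigU (R : realType) (n : nat) (W : nat -> set R) (P : nat) :
  (\sum_(k < P) mixed (\big[setU/set0]_(i < n) W i) P k <=
   \sum_(i < n) \sum_(k < P) mixed (W i) P k)%N.
Proof.
elim: n => [|n IHn].
  rewrite !big_ord0 big1// => k _; apply/eqP; rewrite eqb0 negb_and.
  by apply/orP; left; apply/asboolPn => -[x []].
rewrite !big_ord_recr/=; apply: leq_trans (leq_add IHn (leqnn _)).
rewrite -big_split/=; apply: leq_sum => k _.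
move: (\big[_/_]_(_ < _) _) => V.
case: (boolP (mixed _ _ _)) => // /andP[/asboolP[x [xk xVW]]] /asboolPn VW.
rewrite addn_gt0 !lt0b; apply/orP.
case: xVW => h; [left|right]; apply/andP; split; try by apply/asboolP; exists x.
  by apply/asboolPn => kV; apply: VW => y /kV; left.
by apply/asboolPn => kV; apply: VW => y /kV; right.
Qed.

Lemma lebesgue_measure_ltoo (R : realType) (u v : R) : u <= v ->
  lebesgue_measure (`]u, v[%classic : set R) = (v - u)%:E.
Proof.
rewrite lebesgue_measure_itv/= lte_fin le_eqVlt.
by case: ltP => // _; rewrite orbF => /eqP ->; rewrite subrr.
Qed.

Lemma lebesgue_measure_ltco (R : realType) (u v : R) : u <= v ->
  lebesgue_measure (`[u, v[%classic : set R) = (v - u)%:E.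
Proof.
rewrite lebesgue_measure_itv/= lte_fin le_eqVlt.
by case: ltP => // _; rewrite orbF => /eqP ->; rewrite subrr.
Qed.

(** Only the pieces in cells that miss [V] are counted: they are disjoint from [V] and from one
    another, so their lengths add up. The set [F] outside [V] forces at least [P * m - b] such
    cells. *)
Lemma new_mass (R : realType) (V F : set (measurableTypeR R))
    (J : nat -> set (measurableTypeR R)) (ell m : R) (P b : nat) : (0 < P)%N -> 0 <= ell ->
  (forall k, measurable (J k)) -> measurable V -> measurable F ->
  F `<=` `[0, 1[%classic -> F `&` V = set0 ->
  (forall k, (k < P)%N -> J k `<=` cell P k /\ lebesgue_measure (J k) = ell%:E) ->
  (m%:E <= lebesgue_measure F)%E -> (\sum_(k < P) mixed V P k <= b)%N ->
  (lebesgue_measure V + (ell * (P%:R * m - b%:R))%:E <=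
   lebesgue_measure (V `|`
    \big[setU/set0]_(k < P) J k))%E.
Proof.
move=> P0 ell0 mJ mV mF F01 FV zP mm hb.
have P0R : 0 < P%:R :> R by rewrite ltr0n.
pose good (k : nat) : bool := (k < P)%N && `[< cell P k `&` V = set0 >].
have mcell k : measurable (cell P k : set (measurableTypeR R)) by exact: measurable_itv.
(* The cells not contained in V cover F, and all but b of them miss V. *)
have hm : P%:R * m - b%:R <= (\sum_(k < P) good k)%N%:R.
  rewrite lerBlDr -ler_pdivlMl//.
  rewrite -lee_fin; apply: le_trans mm _.
  pose G (k : nat) : set (measurableTypeR R) :=
    if `[< cell P k `<=` V >] then set0 else cell P k.
  have mG k : measurable (G k) by rewrite /G; case: ifP.
  have FG : F `<=` \big[setU/set0]_(k < P) G k.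
    move=> x Fx; have [k kP xk] := cell_cover P0 (F01 _ Fx).
    rewrite -bigcup_mkord; exists k => //; rewrite /G; case: asboolP => // kV.
    suff : (F `&` V) x by rewrite FV.
    by split => //; exact: kV.
  apply: (@le_trans _ _ (\sum_(k < P) lebesgue_measure (G k))%E).
    apply: le_trans (@Boole_inequality _ _ _ lebesgue_measure G P _) => //.
    by apply: le_measure; rewrite ?inE//; exact: bigsetU_measurable.
  apply: (@le_trans _ _ (\sum_(k < P) (((good k)%:R + (mixed V P k)%:R) / P%:R)%:E)%E).
    apply: lee_sum => k _; rewrite /G; case: asboolP => kV.
      by rewrite measure0 lee_fin divr_ge0// addr_ge0.
    rewrite lebesgue_measure_ltco; last by rewrite ler_pM2r ?invr_gt0// ler_nat.
    rewrite lee_fin -mulrBl -natrB// subSnn ler_pM2r ?invr_gt0//.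
    rewrite /good ltn_ord/= /mixed; case: asboolP => /= [_|/eqP/set0P h].
      by rewrite lerDl.
    rewrite (asboolT h) asboolF//= addrC lerDl//.
  rewrite sumEFin -mulr_suml lee_fin mulrC ler_pM2l ?invr_gt0//.
  rewrite big_split/= -!natr_sum lerD2l ler_nat//.
pose B (k : nat) : set (measurableTypeR R) :=
  if good k then J k else set0.
have mB k : measurable (B k) by rewrite /B; case: ifP.
have BP k : B k `<=` cell P k.
  by rewrite /B /good; case: ifP => [/andP[kP _]|_]; [exact: (zP _ kP).1|exact: sub0set].
have tB : trivIset setT B.
  apply/trivIsetP => i j _ _ ij; apply/seteqP; split => // x [/BP xi /BP xj].
  by move/eqP : ij; apply; exact: cell_inj xi xj.
have mBU : measurable (\big[setU/set0]_(k < P) B k) by exact: bigsetU_measurable.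
apply: (@le_trans _ _ (lebesgue_measure (V `|` \big[setU/set0]_(k < P) B k))); last first.
  apply: le_measure; rewrite ?inE.
  - exact: measurableU.
  - by apply: measurableU => //; exact: bigsetU_measurable.
  - apply: setUS; rewrite -!bigcup_mkord => x [k kP]; rewrite /B.
    by case: ifP => // _ xk; exists k.
rewrite measureU//; last first.
  rewrite -bigcup_mkord setI_bigcupr bigcup0// => k kP.
  rewrite /B; case: ifP => [/andP[_ /asboolP h]|_]; last by rewrite setI0.
  apply/seteqP; split => // x [Vx xB].
  suff : (cell P k `&` V) x by rewrite h.
  by split => //; exact: (zP _ kP).1 xB.
rewrite leeD2l// measure_bigsetU//.
apply: (@le_trans _ _ (\sum_(k < P) (ell * (good k)%:R)%:E)%E).
  by rewrite sumEFin -mulr_sumr -natr_sum lee_fin ler_wpM2l.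
apply: lee_sum => k _; rewrite /B; case: ifP => _; last by rewrite mulr0 measure0.
by rewrite mulr1 -(zP _ (ltn_ord k)).2.
Qed.

(** * Condensation, and the bound on the radii when a set of positive measure is evaded *)

Lemma condensation (R : realType) (f : nat -> R) (N : nat -> nat) (M : nat) (T : R) :
  (forall n, (M <= n)%N -> 0 <= f n) ->
  (forall n p, (M <= n <= p)%N -> f p <= f n) ->
  (forall l, (N l <= N l.+1)%N) -> (forall l, (l <= N l)%N) ->
  (forall L, \sum_(l < L) (N l.+1)%:R * f (M + N l)%N <= T) ->
  forall n, \sum_(M <= k < n) f k <= \sum_(M <= k < M + N 0%N) f k + T.
Proof.
move=> f0 fdec Nmono Nge hT n.
(* On the block from [M + N l] to [M + N l.+1], [f] is at most its value at the left end, and the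
   block has at most [N l.+1] terms. *)
have blocks L : \sum_(M <= k < M + N L) f k <=
    \sum_(M <= k < M + N 0%N) f k + \sum_(l < L) (N l.+1)%:R * f (M + N l)%N.
  elim: L => [|L IHL]; first by rewrite big_ord0 addr0.
  rewrite (big_cat_nat (n := M + N L)) ?leq_addr ?leq_add2l//=.
  rewrite big_ord_recr/= addrA lerD//.
  apply: (@le_trans _ _ (\sum_(M + N L <= k < M + N L.+1) f (M + N L)%N)).
    by apply: ler_sum_nat => k /andP[k1 k2]; apply: fdec; rewrite leq_addr.
  rewrite sumr_const_nat -[leLHS]mulr_natl ler_wpM2r ?f0 ?leq_addr// ler_nat; lia.
apply: (@le_trans _ _ (\sum_(M <= k < M + N n) f k)).
  have [Mn|nM] := leqP M n; last first.
    rewrite big_geq 1?ltnW// big_seq sumr_ge0// => k.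
    by rewrite mem_index_iota => /andP[/f0].
  have nN : (n <= M + N n)%N by rewrite (leq_trans (Nge n)) ?leq_addl.
  rewrite (big_cat_nat Mn nN)/=.
  rewrite lerDl big_seq sumr_ge0// => k; rewrite mem_index_iota => /andP[nk _].
  by apply: f0; exact: leq_trans nk.
by apply: le_trans (blocks n) _; rewrite lerD2l.
Qed.

Lemma powR_mono (R : realType) (s a b : R) : 0 < s -> 0 <= a -> a <= b ->
  a `^ s <= b `^ s.
Proof.
move=> s0 a0 ab; apply: ge0_ler_powR => //; first exact: ltW.
by rewrite nnegrE (le_trans a0).
Qed.

Lemma powR_le_id (R : realType) (s a : R) : 1 <= s -> 0 <= a <= 1 -> a `^ s <= a.
Proof.
move=> s1 /andP[]; rewrite le_eqVlt => /predU1P[<- _|a0 a1].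
  by rewrite powR0 ?gt_eqF//; lra.
by apply: ge1r_powR; rewrite ?a0.
Qed.

Lemma sum_geometric_le (K L : nat) : (0 < K)%N ->
  ((\sum_(l < L) K ^ l) * K.-1 <= K ^ L)%N.
Proof.
move=> K0; elim: L => [|L IHL]; first by rewrite big_ord0.
rewrite big_ord_recr/= mulnDl expnS; apply: leq_trans (leq_add IHL (leqnn _)) _.
by rewrite -mulnS mulnC prednK.
Qed.

(* [0, 1) stands for the circle; ranging over all integers w turns the bound
   into one on the distance modulo 1. *)
Definition evaded (R : realType) (alpha x : R) (r : nat -> R) (M : nat) :
    set (measurableTypeR R) :=
  [set y | 0 <= y < 1 /\ forall n (w : int), (M <= n)%N ->
    r n <= `|y + n%:R * alpha - x - w%:~R|].

(** A ball of radius [r k] in the circle has measure at most [2 * r k], so this bound rules out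
    divergence of the sum of the measures to the power [s]. *)
Lemma evaded_sum_bounded (R : realType) (s alpha x : R) (r : nat -> R) (M : nat) :
  1 <= s -> Omega (s - 1) alpha ->
  (forall n, (M <= n)%N -> 0 <= r n) ->
  (forall n p, (M <= n <= p)%N -> r p <= r n) ->
  measurable (evaded alpha x r M) ->
  (0 < lebesgue_measure (evaded alpha x r M))%E ->
  exists T : R, forall n, \sum_(M <= k < n) (2 * r k) `^ s <= T.
Proof.
move=> s1 Oalpha r0 rdec mF F0.
have s0 : 0 < s by exact: lt_le_trans s1.
have [B B0 net] := orbit_net_Omega s1 Oalpha.
have B1 : 0 < B + 1 by rewrite addr_gt0.
have [m m0 mF'] : exists2 m : R, 0 < m &
    (m%:E <= lebesgue_measure (evaded alpha x r M))%E.
  case: (lebesgue_measure (evaded alpha x r M)) F0 => [m| |//]; last first.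
    by exists 1 => //; rewrite leey.
  by rewrite lte_fin => m0; exists m.
(* With [K - 1 >= 4 / m], the balls of all stages before [L] have at most [P L * m / 2] endpoints in
   total. *)
pose K := (Num.truncn (4 / m)).+2.
have K0 : (0 < K)%N by [].
have K4 : 4 / m <= K.-1%:R.
  by apply: ltW; have /andP[] := @truncn_itv _ (4 / m) (divr_ge0 (ler0n _ 4) (ltW m0)).
pose P l := (K ^ l)%N.
have P0 l : (0 < P l)%N by rewrite expn_gt0.
have P0R l : 0 < (P l)%:R :> R by rewrite ltr0n.
(* The successor rounds up, as the net needs; the summand [l] makes [N] unbounded, as condensation
   needs. *)
pose N l := (Num.truncn (B * (P l)%:R `^ s) + l).+1.
have NB l : B * (P l)%:R `^ s <= (N l)%:R.
  have /andP[_ /ltW h] :=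
    @truncn_itv _ (B * (P l)%:R `^ s) (mulr_ge0 (ltW B0) (powR_ge0 _ _)).
  by apply: le_trans h _; rewrite ler_nat ltnS leq_addr.
have PRpow l : (P l)%:R <= (P l)%:R `^ s :> R.
  by apply: le1r_powR; rewrite // ler1n.
have NB' l : (N l)%:R <= (B + 1) * (P l)%:R `^ s.
  have /andP[h _] :=
    @truncn_itv _ (B * (P l)%:R `^ s) (mulr_ge0 (ltW B0) (powR_ge0 _ _)).
  rewrite /N -addnS natrD mulrDl mul1r lerD//.
  by apply: le_trans (PRpow l); rewrite ler_nat ltn_expl.
have Nmono l : (N l <= N l.+1)%N.
  rewrite ltnS leq_add// le_truncn// ler_pM2l//.
  apply: powR_mono => //; rewrite ler_nat.
  by rewrite /P expnS leq_pmull.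
have Nge l : (l <= N l)%N by rewrite leqW// leq_addl.
(* Since [r] is nonincreasing, each of the [N l] targets at times from [M] on has radius at least
   [rho l]. *)
pose rho l := r (M + N l)%N.
have rho0 l : 0 <= rho l by rewrite r0// leq_addr.
have [y0 Fy0] : evaded alpha x r M !=set0.
  by apply/set0P; apply: contraTneq F0 => ->; rewrite measure0 ltxx.
(* The orbit of an evading point [y0] comes within [1/(4 P l)] of the center [x], yet stays outside
   the target. *)
have rhoP l : rho l <= (4 * (P l)%:R)^-1.
  have [n [w [nN hn]]] := net _ _ (P0 l) (NB l) (x - y0 - M%:R * alpha).
  apply: le_trans (ltW hn).
  apply: (@le_trans _ _ (r (M + n)%N)).
    by apply: rdec; rewrite leq_addr leq_add2l ltnW.
  rewrite (le_trans (Fy0.2 _ w (leq_addr _ _)))// -normrN natrD.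
  by rewrite le_eqVlt; apply/orP; left; apply/eqP; congr `|_|; ring.
(* [z] is a preimage of the center [x], chosen near the midpoint of cell [k]. Offset and radius are
   each at most a quarter of the cell width, so the ball [J l k] around [z] stays in the cell. *)
have zex l k : exists z : R, `|z - (k%:R + 2^-1) / (P l)%:R| < (4 * (P l)%:R)^-1 /\
    forall y, evaded alpha x r M y -> rho l <= `|y - z|.
  pose c : R := (k%:R + 2^-1) / (P l)%:R.
  have [n [w [nN hn]]] := net _ _ (P0 l) (NB l) (x - c - M%:R * alpha).
  exists (x - (M + n)%:R * alpha + w%:~R); split.
    by move: hn; congr (`|_| < _); rewrite natrD /c; ring.
  move=> y [_ /(_ (M + n)%N w (leq_addr _ _)) h].
  apply: (@le_trans _ _ (r (M + n)%N)).
    by apply: rdec; rewrite leq_addr leq_add2l ltnW.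
  by apply: le_trans h _; rewrite le_eqVlt; apply/orP; left; apply/eqP; congr `|_|; ring.
have [z zP] := choice (fun lk : nat * nat => zex lk.1 lk.2).
pose J l k : set (measurableTypeR R) := `]z (l, k) - rho l, z (l, k) + rho l[%classic.
have mJ l k : measurable (J l k) by exact: measurable_itv.
have Jcell l k : J l k `<=` cell (P l) k.
  rewrite /J => y /=; rewrite in_itv/= => /andP[y1 y2]; apply/cellP => //.
  have [+ _] := zP (l, k); rewrite /= ltr_norml => /andP[z1 z2].
  have : k%:R / (P l)%:R <= y < k.+1%:R / (P l)%:R.
    have := rhoP l; move: z1 z2; rewrite -[k.+1%:R]natr1 [(k%:R + 1) / _]mulrDl.
    rewrite [(k%:R + 2^-1) / _]mulrDl invfM => z1 z2 rP.
    apply/andP; split; lra.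
  by rewrite ler_pdivrMr// ltr_pdivlMr// mulrC.
have FJ l k : evaded alpha x r M `&` J l k = set0.
  rewrite /J; apply/seteqP; split => // y [/((zP (l, k)).2 _) + /=].
  rewrite in_itv/= => h1 h2.
  move: h1; rewrite leNgt ltr_norml => /negP; apply.
  by move: h2 => /andP[? ?]; apply/andP; split; lra.
pose A l := \big[setU/set0]_(k < P l) J l k.
pose V L := \big[setU/set0]_(l < L) A l.
have mA l : measurable (A l) by exact: bigsetU_measurable.
have mV L : measurable (V L) by exact: bigsetU_measurable.
have FV L : evaded alpha x r M `&` V L = set0.
  apply/seteqP; split => // y [Fy]; rewrite /V -bigcup_mkord => -[l _].
  rewrite /A -bigcup_mkord => -[k _ yJ].
  suff : (evaded alpha x r M `&` J l k) y by rewrite FJ.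
  by [].
have V1 L : (lebesgue_measure (V L) <= 1)%E.
  rewrite -[leRHS]/(1%:E) -[X in X%:E]subr0 -lebesgue_measure_ltco ?ler01//.
  apply: le_measure; rewrite ?inE//.
  move=> y; rewrite /V -bigcup_mkord => -[l _].
  rewrite /A -bigcup_mkord => -[k /= kP /Jcell/cellP-/(_ (P0 l))/andP[y1 y2]].
  rewrite in_itv/= -(pmulr_rge0 _ (P0R l)) (le_trans _ y1)//=.
  rewrite -(ltr_pM2l (P0R l)) mulr1 (lt_le_trans y2)// ler_nat//.
have mixV L : (\sum_(k < P L) mixed (V L) (P L) k <= 2 * \sum_(l < L) P l)%N.
  apply: leq_trans (sum_mixed_bigU _ _ _) _.
  rewrite big_distrr/=; apply: leq_sum => l _.
  apply: leq_trans (sum_mixed_bigU _ _ _) _.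
  apply: (@leq_trans (\sum_(i < P l) 2)); last by rewrite sum_nat_const card_ord mulnC.
  by apply: leq_sum => k _; exact: sum_mixed_itv.
have mixm L : (2 * \sum_(l < L) P l)%N%:R <= (P L)%:R * m / 2.
  have h : (\sum_(l < L) P l)%N%:R * (4 / m) <= (P L)%:R :> R.
    apply: (@le_trans _ _ ((\sum_(l < L) P l)%N%:R * K.-1%:R)).
      by rewrite ler_wpM2l.
    by rewrite -natrM ler_nat sum_geometric_le.
  move: h; rewrite mulrA ler_pdivrMr// natrM; lra.
(* Mixed cells cost at most half of [P L * m]; the length [2 * rho L] of each piece compensates for
   this half. *)
have Vmass L : (lebesgue_measure (V L) + (rho L * (P L)%:R * m)%:E <=
    lebesgue_measure (V L.+1))%E.
  rewrite [V L.+1]big_ord_recr/=.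
  apply: le_trans (@new_mass _ (V L) (evaded alpha x r M) (J L) (2 * rho L) m
    (P L) _ (P0 L) _ _ _ _ _ _ _ _ (mixV L)) => //.
  - rewrite leeD2l// lee_fin.
    have := mixm L; move: (_%:R) (_%:R) (rho0 L) => a b c d.
    nra.
  - by rewrite mulr_ge0.
  - by move=> y [].
  - move=> k _; split; first exact: Jcell.
    by rewrite lebesgue_measure_ltoo; [congr _%:E; ring|have := rho0 L; lra].
have sumV L : ((\sum_(l < L) rho l * (P l)%:R * m)%:E <= lebesgue_measure (V L))%E.
  elim: L => [|L IHL]; first by rewrite big_ord0.
  rewrite big_ord_recr EFinD; apply: le_trans (Vmass L); exact: leeD2r.
exists (\sum_(M <= k < M + N 0%N) (2 * r k) `^ s + (B + 1) * K%:R `^ s * (2 / m)).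
apply: condensation => //.
- by move=> n _; exact: powR_ge0.
- move=> n p np; have /andP[Mn nN] := np; apply: powR_mono => //.
    by rewrite mulr_ge0// r0// (leq_trans Mn).
  by rewrite ler_pM2l// rdec.
(* [N l.+1] is at most [(B + 1) * K^s * (P l)^s], and the factor [(P l)^s] combines with
   [(2 * rho l)^s] into the [s]-th power of a number in [[0, 1]], which is at most that number. *)
move=> L; apply: (@le_trans _ _
    (\sum_(l < L) (B + 1) * K%:R `^ s * (2 * rho l * (P l)%:R))).
  apply: ler_sum => l _.
  apply: (@le_trans _ _ ((B + 1) * (P l.+1)%:R `^ s * (2 * rho l) `^ s)).
    by rewrite ler_wpM2r ?powR_ge0.
  rewrite /P expnS natrM powRM// -!mulrA !ler_pM2l ?powR_gt0 ?ltr0n//.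
  rewrite [_ `^ s * _]mulrC -powRM//; last by rewrite mulr_ge0.
  rewrite !mulrA; apply: powR_le_id => //; rewrite !mulr_ge0//=.
  have := rhoP l; rewrite invfM => h.
  have Pi : 0 <= (P l)%:R^-1 :> R by rewrite invr_ge0.
  rewrite -ler_pdivlMr//; lra.
rewrite -mulr_sumr ler_pM2l ?mulr_gt0 ?powR_gt0 ?ltr0n//.
rewrite ler_pdivlMr//.
have := le_trans (sumV L) (V1 L); rewrite lee_fin.
rewrite -(ler_pM2l (ltr0n R 2 : 0 < 2%:R)) mulr1; congr (_ <= _).
by rewrite mulr_sumr mulr_suml; apply: eq_bigr => l _; rewrite !mulrA.
Qed.

(** * Balls, Haar measure and limsup sets on the circle *)

Lemma infinite_set_natP (A : set nat) :
  infinite_set A <-> forall M, exists2 n, (M <= n)%N & A n.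
Proof.
split=> [Ainf M|Aunb /finite_seqP[t At]].
  apply: contrapT => noA; apply: Ainf; apply: (@sub_finite_set _ _ `I_M) => // n An.
  by rewrite /= ltnNge; apply/negP => Mn; apply: noA; exists n.
have [n nt An] := Aunb (\max_(i <- t) i).+1.
suff : (n <= \max_(i <- t) i)%N by rewrite leqNgt nt.
by apply: leq_bigmax_seq => //; move: An; rewrite At.
Qed.

Section circle_facts.
Context (R : realType).
Implicit Types (x y : circle R) (a b e : R).

Lemma circle_ball_open x e : open (ball x e).
Proof.
rewrite openE => y; rewrite ballEmdist/= => xye.
apply/nbhs_ballP; exists (e - mdist x y); first by rewrite /= subr_gt0.
move=> z; rewrite !ballEmdist/= => yz; apply: le_lt_trans (metric_triangle x y z) _.
by rewrite addrC -ltrBrDr.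
Qed.

Lemma measurable_circle_ball x e : measurable (ball x e).
Proof. exact/measurable_open/circle_ball_open. Qed.

Lemma toC0 : toC 0 = 0 :> circle R.
Proof. by apply: (addrI (toC 0)); rewrite -toCD !addr0. Qed.

Lemma iter_rotation (alpha : R) n y :
  iter n (rotation_map alpha) y = y + toC (n%:R * alpha).
Proof.
elim: n => [|n IHn] /=.
  by rewrite mul0r toC0 addr0.
by rewrite IHn /rotation_map -addrA -toCD -[n.+1%:R]natr1 mulrDl mul1r.
Qed.

Lemma measurable_rotation_preimage (alpha : R) n (A : set (circle R)) :
  measurable A -> measurable (iter n (rotation_map alpha) @^-1` A).
Proof.
move=> mA; rewrite (_ : iter n _ = rotation_map (n%:R * alpha)).
  by rewrite -[_ @^-1` _]setTI; exact: measurable_rotation.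
by apply/funext => y; rewrite iter_rotation.
Qed.

Lemma not_ballP a b e :
  ~ ball (toC a) e (toC b) <-> forall w : int, e <= `|b - a - w%:~R|.
Proof.
rewrite ball_circleE -opprB dist_intN; split => [/negP|h].
  by rewrite -leNgt => h w; exact: le_trans h (dist_int_le _ _).
by apply/negP; rewrite -leNgt; exact: dist_int_ge.
Qed.

Lemma haar_le1 (A : set (circle R)) : measurable A -> (haar A <= 1)%E.
Proof. by move=> mA; rewrite -(@haar_setT R); apply: le_measure; rewrite ?inE. Qed.

Lemma haar_ball x e : haar (ball x e) = haar (ball (0 : circle R) e).
Proof.
rewrite -(haar_rotation (- repr x) (measurable_circle_ball 0 e)).
congr (haar _); apply/seteqP; split => y;
  by rewrite /rotation_map /= !ballEmdist/= /mdist/= /circle_dist toCN toCK sub0r opprB.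
Qed.

(** Centered at 0, the ball is covered in [[0, 1[] by an interval of length [e] at each end. These
    may overlap when [e] is large. *)
Lemma haar_ball_le x e : 0 <= e -> (haar (ball x e) <= (2 * e)%:E)%E.
Proof.
move=> e0; rewrite haar_ball haarE.
rewrite -toC0.
have mA : measurable (`[0, e[%classic `|` `]1 - e, 1[%classic : set (measurableTypeR R)).
  by apply: measurableU; exact: measurable_itv.
apply: (@le_trans _ _ (lebesgue_measure
  (`[0, e[%classic `|` `]1 - e, 1[%classic : set (measurableTypeR R)))).
  apply: le_measure; rewrite ?inE//.
    apply: measurableI; last exact: measurable_itv.
    rewrite -[_ @^-1` _]setTI; apply: measurable_toC => //; exact: measurable_circle_ball.
  move=> b [/= bb]; rewrite in_itv/= => /andP[b0 b1].
  have : exists w : int, `|b - w%:~R| < e.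
    apply: contrapT => h; have : ball (toC 0) e (toC b) by [].
    by apply/not_ballP => w; rewrite subr0 leNgt; apply/negP => bw; apply: h; exists w.
  move=> [w]; have [w0|w1] := leP w 0.
    have wR : w%:~R <= 0 :> R by rewrite lerz0.
    rewrite ltr_norml => /andP[_ h]; left; rewrite /= in_itv/= b0/=; lra.
  have wR : 1 <= w%:~R :> R by rewrite ler1z.
  rewrite ltr_norml => /andP[h _]; right; rewrite /= in_itv/= b1 andbT; lra.
apply: le_trans (measureU2 _ _ _) _; [exact: measurable_itv|exact: measurable_itv|].
rewrite [leLHS](_ : _ = (e - 0)%:E + (1 - (1 - e))%:E)%E; last first.
  by congr (_ + _)%E; [exact: lebesgue_measure_ltco|apply: lebesgue_measure_ltoo; lra].
by rewrite -EFinD lee_fin; lra.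
Qed.

(** The one-sided part [[0, e[] of the ball at 0 suffices. This bound holds up to [e = 1], where
    [2 * e] would exceed the total measure. *)
Lemma haar_ball_ge x e : 0 <= e <= 1 -> (e%:E <= haar (ball x e))%E.
Proof.
move=> /andP[e0 e1]; rewrite haar_ball haarE.
rewrite -toC0.
rewrite -[e in e%:E]subr0 -lebesgue_measure_ltco//.
apply: le_measure; rewrite ?inE//.
  apply: measurableI; last exact: measurable_itv.
  rewrite -[_ @^-1` _]setTI; apply: measurable_toC => //; exact: measurable_circle_ball.
move=> b /=; rewrite in_itv/= => /andP[b0 be]; split; last first.
  by rewrite in_itv/= b0 (lt_le_trans be).
rewrite /= ball_circleE (le_lt_trans (dist_int_le _ 0))// sub0r subr0 normrN ger0_norm//.
Qed.

End circle_facts.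

(** The strict inequality excludes time 0 even for [M = 0], in agreement with [limsup_preimage]. *)
Definition tail_avoid (T : Type) (f : T -> T) (A : nat -> set T) (M : nat) : set T :=
  [set y | forall n, (M < n)%N -> ~ A n (iter n f y)].

Lemma limsup_preimageE (R : realType) (f : circle R -> circle R)
    (A : nat -> set (circle R)) :
  limsup_preimage f A = ~` \bigcup_M tail_avoid f A M.
Proof.
apply/seteqP; split => y /=.
  move=> /infinite_set_natP yinf [M _ FMy].
  by have [n Mn [_]] := yinf M.+1; exact: FMy.
move=> yF; apply/infinite_set_natP => M; apply: contrapT => h.
apply: yF; exists M => // n Mn yn; apply: h; exists n; first exact: ltnW.
by split => //; exact: leq_ltn_trans Mn.
Qed.

Lemma measurable_tail_avoid (R : realType) (alpha : R) (A : nat -> set (circle R)) M :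
  (forall n, measurable (A n)) ->
  measurable (tail_avoid (rotation_map alpha) A M).
Proof.
move=> mA; rewrite (_ : tail_avoid _ _ _ = \bigcap_(n in [set n | (M < n)%N])
    (iter n (rotation_map alpha) @^-1` (~` A n)))//.
apply: bigcap_measurableType => n _; apply: measurable_rotation_preimage.
exact: measurableC.
Qed.

Lemma measurable_limsup_rotation (R : realType) (alpha : R)
    (A : nat -> set (circle R)) : (forall n, measurable (A n)) ->
  measurable (limsup_preimage (rotation_map alpha) A).
Proof.
move=> mA; rewrite limsup_preimageE; apply: measurableC.
by apply: bigcup_measurable => M _; exact: measurable_tail_avoid.
Qed.

(** * Sufficiency of the Diophantine condition *)

Lemma sMSTP_rotation_Omega (R : realType) (s : R) (alpha : R) : 1 <= s ->
  Omega (s - 1) alpha -> sMSTP s (rotation alpha).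
Proof.
move=> s1 Oalpha x r rDR hsum; have s0 : 0 < s by exact: lt_le_trans s1.
have r0 n : (0 < n)%N -> 0 <= r n by move=> /rDR[].
have rdec n p : (0 < n <= p)%N -> r p <= r n.
  move=> /andP[n0]; elim: p => [|p IHp]; first by rewrite leqn0 => /eqP ->.
  rewrite leq_eqVlt => /predU1P[-> //|]; rewrite ltnS => np.
  by apply: le_trans (IHp np); have [] := rDR p (leq_trans n0 np).
pose h n := haar (ball x (r n)).
have h1 n : (h n <= 1)%E by apply: haar_le1; exact: measurable_circle_ball.
have h0 n : (0 <= h n)%E by exact: haar_ge0.
have hsum' : (\sum_(1 <= n <oo) (h n `^ s) = +oo)%E by exact: hsum.
(* Measures are at most 1 and [s >= 1], so divergence with exponent [s] implies the divergence of
   the sum of the measures that [Borel_Cantelli] includes. *)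
have hs n : (h n `^ s <= h n)%E.
  move: (h n) (h0 n) (h1 n) => [a| |]//; rewrite !lee_fin => a0 a1.
  by rewrite powR_le_id// a0.
split.
- by move=> n _; exact: measurable_circle_ball.
- apply/eqP; rewrite -leye_eq -[leLHS]hsum; apply: lee_nneseries => n *.
    exact: poweR_ge0.
  exact: hs.
pose F M := tail_avoid (rotation_map alpha) (fun n => ball x (r n)) M.
have mF M : measurable (F M).
  by apply: measurable_tail_avoid => n; exact: measurable_circle_ball.
have limsupE : limsup_preimage (rotation_map alpha) (fun n => ball x (r n)) =
    ~` \bigcup_M F M.
  exact: limsup_preimageE.
(* The shift to [M.+1] turns the strict bound of [tail_avoid] into the large one of [evaded]. *)
have evE M : (@toC R) @^-1` F M `&` `[0, 1[%classic = evaded alpha (repr x) r M.+1.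
  apply/seteqP; split => a.
    move=> [Fa]; rewrite /= in_itv/= => a01; split => // n w Mn.
    move: (Fa n Mn); rewrite iter_rotation -[in ball _](toCK x) -toCD.
    by move/not_ballP; exact.
  move=> [a01 ha]; split; last by rewrite /= in_itv.
  move=> n Mn; rewrite iter_rotation -[in ball _](toCK x) -toCD.
  by apply/not_ballP => w; exact: ha.
(* Positive measure would bound the sum of the [(2 * r k)^s], hence that of the [h k ^ s], against
   [hsum']. The limsup set is then the complement of a countable union of null sets. *)
have F0 M : haar (F M) = 0%E.
  apply/eqP; rewrite eq_le haar_ge0 andbT leNgt; apply/negP => FM.
  have [T hT] : exists T : R, forall n, \sum_(M.+1 <= k < n) (2 * r k) `^ s <= T.
    apply: (@evaded_sum_bounded R s alpha (repr x) r M.+1 s1 Oalpha).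
    - by move=> n Mn; apply: r0; exact: leq_trans Mn.
    - by move=> n p /andP[Mn np]; apply: rdec; rewrite np andbT; exact: leq_trans Mn.
    - rewrite -evE; apply: measurableI; last exact: measurable_itv.
      by rewrite -[_ @^-1` _]setTI; apply: measurable_toC.
    - by rewrite -evE.
  have hk k : (0 < k)%N -> (h k `^ s <= ((2 * r k) `^ s)%:E)%E.
    move=> k0; rewrite -poweR_EFin; apply: gt0_ler_poweR; first exact: ltW.
    - by rewrite in_itv/= h0 leey.
    - by rewrite in_itv/= leey lee_fin mulr_ge0// r0.
    - by rewrite haar_ball_le// r0.
  suff : (\sum_(1 <= n <oo) (h n `^ s) <= (\sum_(1 <= k < M.+1) (2 * r k) `^ s + T)%:E)%E.
    by rewrite hsum' leye_eq.
  apply: lime_le; first by apply: is_cvg_nneseries => n *; exact: poweR_ge0.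
  apply: nearW => n.
  apply: (@le_trans _ _ (\sum_(1 <= k < M.+1 + n) (h k `^ s))%E).
    by apply: lee_sum_nneg_natr; [move=> *; exact: poweR_ge0|rewrite leq_addl].
  apply: (@le_trans _ _ (\sum_(1 <= k < M.+1 + n) ((2 * r k) `^ s)%:E)%E).
    rewrite !big_seq; apply: lee_sum => k; rewrite mem_index_iota.
    by move=> /andP[k0 _]; exact: hk.
  rewrite sumEFin lee_fin (big_cat_nat (n := M.+1))//=; last by rewrite leq_addr.
  by rewrite lerD2l.
have mUF : measurable (\bigcup_M F M) by exact: bigcup_measurable.
have UF0 : haar (\bigcup_M F M) = 0%E.
  apply/eqP; rewrite eq_le haar_ge0 andbT.
  apply: le_trans (measure_sigma_subadditive (@haar R) mF mUF (@subset_refl _ _)) _.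
  by rewrite eseries0// => M _ _; exact: F0.
rewrite [LHS](_ : _ = haar (~` \bigcup_M F M)); last by rewrite -limsupE.
have := measureU (@haar R) mUF (measurableC mUF) (setICr _).
rewrite setUv => hU; apply: esym; apply: etrans hU _.
by rewrite -[RHS]add0e; congr (_ + _)%E.
Qed.

(** * Necessity of the Diophantine condition *)

Lemma dist_int_natmul (R : realType) (a : R) n : dist_int (n%:R * a) <= n%:R * dist_int a.
Proof.
elim: n => [|n IHn]; first by rewrite !mul0r (le_trans (dist_int_le _ 0))// subrr normr0.
rewrite -[n.+1%:R]natr1 !mulrDl !mul1r; apply: le_trans (dist_intD _ _) _.
by rewrite lerD2r.
Qed.

(* The orbit stays so close to a periodic orbit of length q that its first N
   balls are contained in q slightly larger ones. *)
Lemma orbit_balls_small (R : realType) (s alpha eps T : R) : 1 <= s ->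
  ~ Omega (s - 1) alpha -> 0 < eps <= 1 -> 0 <= T ->
  exists N : nat, exists rho : R,
    [/\ 0 < rho <= 1, T <= N%:R * rho `^ s &
     (haar (\bigcup_(n in [set n | (n <= N)%N])
        (iter n (rotation_map alpha) @^-1` ball (0%R : circle R) rho)) <=
      (4 * eps)%:E)%E].
Proof.
move=> s1 nO /andP[e0 e1] T0; have s0 : 0 < s by exact: lt_le_trans s1.
have es0 : 0 < eps `^ s by rewrite powR_gt0.
(* [D0] is chosen so that [N <= D + 1 <= D0 * q^s] below; taking [eps / D0] as the constant violated
   by [q] then gives [N * delta <= eps]. *)
pose D0 := T / eps `^ s + 1.
have D00 : 0 < D0 by rewrite ltr_wpDl// divr_ge0// ltW.
have [q q0 qd] : exists2 q : nat, (0 < q)%N &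
    dist_int (q%:R * alpha) < eps / D0 * q%:R `^ (- s).
  apply: contrapT => h; apply: nO; exists (eps / D0); first by rewrite divr_gt0.
  move=> k k0; rewrite [1 + _]addrC subrK leNgt; apply/negP => kd.
  by apply: h; exists k.
move: qd; set delta := dist_int _ => qd.
have d0 : 0 <= delta by exact: dist_int_ge0.
have q0R : 0 < q%:R :> R by rewrite ltr0n.
have qs0 : 0 < q%:R `^ s by rewrite powR_gt0.
have qs1 : 1 <= q%:R `^ s by apply: le_trans (le1r_powR _ s1); rewrite ler1n.
pose rho := eps / q%:R.
have rho0 : 0 < rho by rewrite divr_gt0.
pose D := T / rho `^ s.
have DE : D = T / eps `^ s * q%:R `^ s.
  rewrite /D /rho powRM ?invr_ge0// ?ltW// -[q%:R^-1]powR_inv1// -powRrM mulN1r powRN.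
  by rewrite invfM invrK mulrA.
have D1 : 0 <= D by rewrite divr_ge0 ?powR_ge0.
have /andP[N1 N2] := truncn_itv D1.
pose N := (Num.truncn D).+1; exists N, rho; split.
- by rewrite rho0 ler_pdivrMr// mul1r (le_trans e1)// ler1n.
- by rewrite -ler_pdivrMr ?powR_gt0// ltW.
have Ndelta : N%:R * delta <= eps.
  have qd' : q%:R `^ s * delta <= eps / D0.
    by move: qd; rewrite powRN ltr_pdivlMr// mulrC => /ltW.
  apply: (@le_trans _ _ ((D0 * q%:R `^ s) * delta)).
    rewrite ler_wpM2r// -natr1 mulrDl mul1r -DE lerD//.
  by rewrite -mulrA -ler_pdivlMl// [_^-1 * _]mulrC.
(* Writing [n = (n / q) * q + n mod q], the point at time [n] has drifted by at most
   [(N / q) * delta] from the one at time [n mod q]; [e] adds this drift to [rho]. *)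
pose e := rho + N%:R / q%:R * delta.
have e_ge0 : 0 <= e by apply: addr_ge0; [exact: ltW|rewrite mulr_ge0// divr_ge0].
pose A i := iter i (rotation_map alpha) @^-1` ball (0 : circle R) e.
have mA i : measurable (A i).
  by apply: measurable_rotation_preimage; exact: measurable_circle_ball.
apply: (@le_trans _ _ (haar (\big[setU/set0]_(i < q) A i))).
  apply: le_measure; rewrite ?inE.
  - apply: bigcup_measurable => n _; apply: measurable_rotation_preimage.
    exact: measurable_circle_ball.
  - exact: bigsetU_measurable.
  move=> y [n /= nN]; rewrite -bigcup_mkord => yn.
  exists (n %% q)%N; first by rewrite /= ltn_mod.
  move: yn; rewrite /A /= !iter_rotation -(toCK y) -toC0 -!toCD !ball_circleE.
  rewrite !sub0r !dist_intN => yn.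
  apply: (@le_lt_trans _ _ (dist_int (repr y + n%:R * alpha) +
    dist_int (- ((n %/ q)%:R * (q%:R * alpha))))).
    apply: le_trans (dist_intD _ _).
    rewrite {2}(divn_eq n q) natrD natrM le_eqVlt; apply/orP; left.
    by apply/eqP; congr dist_int; ring.
  rewrite dist_intN ltr_leD//; apply: le_trans (dist_int_natmul _ _) _.
  rewrite ler_wpM2r// ler_pdivlMr// -natrM ler_nat (leq_trans (leq_trunc_div _ _))//.
apply: le_trans (@Boole_inequality _ _ _ (@haar R) A q _) _ => //.
(* The [q] enlarged balls have total measure at most [2 * q * e = 2 * (eps + N * delta) <= 4 *
   eps]. *)
apply: (@le_trans _ _ (\sum_(i < q) (2 * e)%:E)%E).
  apply: lee_sum => i _.
  rewrite (_ : A i = rotation_map (i%:R * alpha) @^-1` ball (0 : circle R) e); last first.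
    by apply/seteqP; split => y; rewrite /A /= iter_rotation.
  apply: le_trans (haar_ball_le (0 : circle R) e_ge0); rewrite le_eqVlt; apply/orP; left.
  by apply/eqP/haar_rotation; exact: measurable_circle_ball.
rewrite sumEFin lee_fin sumr_const card_ord -[leLHS]mulr_natl /e /rho.
have -> : q%:R * (2 * (eps / q%:R + N%:R / q%:R * delta)) = 2 * (eps + N%:R * delta).
  by field; rewrite gt_eqF.
lra.
Qed.

(** The targets built here satisfy the divergence hypothesis, yet the points that hit even one of
    them at a positive time have measure at most [1/2]. *)
Lemma Omega_of_sMSTP (R : realType) (s alpha : R) : 1 <= s ->
  sMSTP s (rotation alpha) -> Omega (s - 1) alpha.
Proof.
move=> s1 mstp; apply: contrapT => nO; have s0 : 0 < s by exact: lt_le_trans s1.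
(* The divisor 4 cancels the factor in [orbit_balls_small]; the bounds [4 * eps j] then sum to
   [1/2]. *)
pose eps j : R := 2^-1 / (2 ^ j.+1)%:R / 4.
have eps01 j : 0 < eps j <= 1.
  have p1 : 1 <= (2 ^ j.+1)%:R :> R by rewrite ler1n expn_gt0.
  have p0 : 0 < (2 ^ j.+1)%:R :> R by exact: lt_le_trans p1.
  by rewrite /eps !divr_gt0//= !ler_pdivrMr//; lra.
have Nrho_ex j : exists Nrho : nat * R,
    [/\ 0 < Nrho.2 <= 1, j%:R <= Nrho.1%:R * Nrho.2 `^ s &
     (haar (\bigcup_(n in [set n | (n <= Nrho.1)%N])
        (iter n (rotation_map alpha) @^-1` ball (0%R : circle R) Nrho.2)) <=
      (4 * eps j)%:E)%E].
  by have [N [rho h]] := orbit_balls_small s1 nO (eps01 j) (ler0n R j); exists (N, rho).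
have {Nrho_ex} [Nrho NrhoP] := choice Nrho_ex.
pose N j := (Nrho j).1; pose rho j := (Nrho j).2.
(* As a supremum, r is nonincreasing however the N j and rho j are ordered. *)
pose S n : set R := [set t | t = 0 \/ exists2 j, (n <= N j)%N & t = rho j].
have S0 n : S n !=set0 by exists 0; left.
have S1 n : ubound (S n) 1.
  by move=> t [->//|[j _ ->]]; have [/andP[]] := NrhoP j.
have Sub n : has_ubound (S n) by exists 1; exact: S1.
pose r n := sup (S n).
have r0 n : 0 <= r n by apply: ub_le_sup => //; left.
have r1 n : r n <= 1 by exact: ge_sup.
have rhor j n : (n <= N j)%N -> rho j <= r n.
  by move=> nj; apply: ub_le_sup => //; right; exists j.
have DRr : DR r.
  move=> n _; split=> //; apply: ge_sup => // t [->|[j nj ->]]; first exact: r0.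
  by apply: rhor; exact: ltnW.
pose h n := haar (ball (0 : circle R) (r n)).
have hge n : ((r n)%:E <= h n)%E by apply: haar_ball_ge; rewrite r0 r1.
(* The radii at times 1 to [N j] are at least [rho j], so these terms alone contribute
   [N j * (rho j)^s >= j]. *)
have hsum : (\sum_(1 <= n <oo) (h n `^ s) = +oo)%E.
  apply/eqyP => A A0; pose j := (Num.truncn A).+1.
  have Aj : A <= j%:R by have /andP[_ /ltW] := truncn_itv (ltW A0).
  apply: le_trans (nneseries_lim_ge (N j).+1 _); last by move=> *; exact: poweR_ge0.
  have [/andP[rj0 _] hj _] := NrhoP j.
  apply: (@le_trans _ _ (\sum_(1 <= n < (N j).+1) ((rho j) `^ s)%:E)%E).
    rewrite sumEFin lee_fin sumr_const_nat subn1 -[leRHS]mulr_natl.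
    exact: le_trans hj.
  rewrite !big_seq; apply: lee_sum => n; rewrite mem_index_iota ltnS => /andP[_ nj].
  rewrite -poweR_EFin; apply: gt0_ler_poweR; first exact: ltW.
  - by rewrite in_itv/= leey lee_fin ltW.
  - by rewrite in_itv/= leey haar_ge0.
  - by apply: le_trans (hge n); rewrite lee_fin rhor.
have [_ _] := mstp 0 r DRr hsum.
pose U j := \bigcup_(n in [set n | (n <= N j)%N])
   (iter n (rotation_map alpha) @^-1` ball (0%R : circle R) (rho j)).
have mU j : measurable (U j).
  apply: bigcup_measurable => n _; apply: measurable_rotation_preimage.
  exact: measurable_circle_ball.
pose L := limsup_preimage (rotation_map alpha) (fun n => ball (0 : circle R) (r n)).
have mL : measurable L.
  by apply: measurable_limsup_rotation => n; exact: measurable_circle_ball.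
have LU : L `<=` \bigcup_j U j.
  move=> y /infinite_set_natP/(_ 0%N)[n _ [_]]; rewrite ballEmdist/= => yr.
  (* A distance below the supremum [r n] is below some element of [S n]; it cannot be 0, so it is a
     [rho j] with [n <= N j]. *)
  have [t [->|[j nj ->]] yt] := sup_gt (S0 n) yr.
    by move: yt; rewrite ltNge mdist_ge0.
  by exists j => //; exists n => //=; rewrite ballEmdist.
move=> /eqP; apply/negP; rewrite lt_eqF//.
apply: (@le_lt_trans _ _ (2^-1)%:E); last first.
  rewrite [ltRHS](@haar_setT R) lte_fin; lra.
apply: le_trans (measure_sigma_subadditive (@haar R) mU mL LU) _.
apply: le_trans (epsilon_trick0 xpredT _); last by rewrite invr_ge0.
apply: lee_nneseries => j *; first exact: haar_ge0.
have [_ _ hj] := NrhoP j; apply: le_trans hj _.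
by rewrite lee_fin /eps mulrC divfK.
Qed.

Theorem theorem1p5 (R : realType) (s : R) (hs : 1 <= s) (alpha : R) :
  sMSTP s (rotation alpha) <-> Omega (s - 1) alpha.
Proof.
split; [exact: Omega_of_sMSTP|exact: sMSTP_rotation_Omega].
Qed.
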